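(* Let $m$ and $d$ be integers with $2\le d<m\le 2d-1$, and let $H_{m,d}(x)=\sum_{n=1}^{\infty}h_{m,d}(n)x^n$ be the generating function for the entropies of the levels of the $(m,d)$-graph (uniform case). Then there exists a function $T_{m,d}(x)$, analytic on the open disk of radius $m$ about $0$ in $\mathbb{C}$, such that $$H_{m,d}(x)=\frac{x}{(x-1)^2}\,T_{m,d}(x).$$ (The identity holds for $|x|<1$, and thus provides an analytic continuation of $H_{m,d}$.)
   Context: For integers $2\le d<m\le 2d-1$ let $S_j(x)=\frac{x}{d}+\frac{j}{d}\cdot\frac{d-1}{m-1}$ for $j=0,1,\dots,m-1$. For a word $\sigma=(\sigma_1,\dots,\sigma_n)\in\{0,\dots,m-1\}^n$ of length $|\sigma|=n$ put $S_\sigma=S_{\sigma_1}\circ\cdots\circ S_{\sigma_n}$ (with $S_\emptyset=\mathrm{id}$). The $(m,d)$-graph has as its nodes at level $n\ge 0$ the set $g_n$ of distinct real numbers of the form $S_\sigma(0)$, $|\sigma|=n$; a node $S_\sigma(0)$ at level $n$ is connected to the nodes $S_{\sigma i}(0)$, $i=0,\dots,m-1$, at level $n+1$. For $z\in g_n$, $\mathrm{freq}(z)$ is the number of paths from the root (level $0$) to $z$, equivalently the number of words $\sigma$ with $|\sigma|=n$ and $S_\sigma(0)=z$. The entropy of level $n$ in the uniform case (all probabilities equal to $1/m$) is $$h_{m,d}(n)=-\sum_{z\in g_n}\bigl(m^{-n}\mathrm{freq}(z)\bigr)\log_2\bigl(m^{-n}\mathrm{freq}(z)\bigr).$$ In particular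 $h_{m,d}(0)=0$. *)

(* Defs.v *)
From Stdlib Require Import Reals List.
From Coquelicot Require Import Coquelicot.

Open Scope R_scope.

(** Contraction [S_j], for [0 <= j <= m - 1]. *)
Definition contraction (m d j : nat) (x : R) : R :=
  x / INR d + INR j / INR d * ((INR d - 1) / (INR m - 1)).

(** [S_sigma = S_{sigma_1} o ... o S_{sigma_n}]: the first letter is the
    outermost map, so the children of [S_sigma 0] are the
    [S_(sigma ++ i :: nil) 0]. *)
Definition word_map (m d : nat) (sigma : list nat) (x : R) : R :=
  fold_right (contraction m d) x sigma.

(** All words of length [n] over [{0, ..., m - 1}], each listed once. *)
Fixpoint words (m n : nat) : list (list nat) :=
  match n with
  | O => nil :: nil
  | S n' => flat_map (fun i => map (cons i) (words m n')) (seq 0 m)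
  end.

Definition endpoints (m d n : nat) : list R :=
  map (fun sigma => word_map m d sigma 0) (words m n).

(** The set [g_n], as a duplicate-free list. *)
Definition level (m d n : nat) : list R :=
  nodup Req_dec_T (endpoints m d n).

(** Number of words [sigma] of length [n] with [S_sigma 0 = z].  These are the
    paths from the root to [z]: the consecutive nodes of a path determine the
    letters of the word. *)
Definition freq (m d n : nat) (z : R) : nat :=
  count_occ Req_dec_T (endpoints m d n) z.

Definition log2 (x : R) : R := ln x / ln 2.

Definition node_prob (m d n : nat) (z : R) : R :=
  / INR m ^ n * INR (freq m d n z).

Definition level_entropy (m d n : nat) : R :=
  - fold_right Rplus 0
      (map (fun z => node_prob m d n z * log2 (node_prob m d n z))
           (level m d n)).

(** [f] is the sum of a power series on a neighbourhood of [z0]. *)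
Definition analytic_at (f : C -> C) (z0 : C) : Prop :=
  exists (a : nat -> C) (r : R), 0 < r /\
    forall z : C, Cmod (z - z0) < r ->
      is_pseries (K := C_AbsRing) (V := C_NormedModule) a (z - z0)%C (f z).

Definition analytic_on (D : C -> Prop) (f : C -> C) : Prop :=
  forall z : C, D z -> analytic_at f z.

(* Main.v *)
Require Import Defs.
From Stdlib Require Import Reals List FinFun Permutation ClassicalEpsilon Lra Lia Psatz.
From Coquelicot Require Import Coquelicot.

Open Scope R_scope.

(** Up to a scaling depending on the level [n] only, the node of a word is the
    integer with that word as its base-[d] expansion with digits below [m], so
    the frequencies at level [n] are the numbers [f_n(N)] of such expansions.
    Put [e = m - d].  Reading the last digit gives
    [f_(n+1)(d q + r) = f_n(q) + (f_n(q - 1) if r < e)]; hence the sum of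
    [psi(f_n(q - 1), f_n(q))] over [q] at level [n + 1] is the sum at level [n]
    of an explicit operator applied to [psi] ([level_sum_S]).

    With [phi(x) = x ln x], let [A_n], [B_n], [R_n] be the sums of [phi(b)], of
    [phi(a + b)] and of [F(a, b) = phi(2a + b) + phi(a + 2b) - 3 phi(a + b)]
    over the pairs [(a, b)] of neighbouring frequencies.  The level entropy is
    [(n ln m - A_n / m^n) / ln 2], and [(A, B)] satisfies a linear recurrence
    whose matrix has the eigenvalues [m] and [1], with [R_n] and a multiple of
    [m^n] as forcing terms.  The function [F] is homogeneous of degree one, which
    turns the recurrence for [R] into [R_(n+1) = m R_n + (m - 1) delta_n]
    ([level_sum_defect]), where [delta_n] is the failure of additivity on the
    standard basis of the [n]-th iterate on [F] of
    [G |-> G(a, a + b) + G(a + b, b)].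

    The numbers [delta_n] are bounded ([gap_iter_mediant_entropy_bound]).  The
    iterate is a sum over words in two unimodular matrices; reading the words
    backwards, [delta_n] is the sum over the [n]-th generation of the Farey tree
    of the additivity defects [F(u + v) - F(u) - F(v)].  Such a defect is at most
    [1 / (s s')] in absolute value, with [s], [s'] the coordinate sums of [u] and
    [v], and [1 / (s s')] is the length of a Farey interval, so these bounds add
    up to [1] in every generation.

    Consequently [A] is annihilated by [(E - m)^2 (E - 1)], [E] being the shift,
    up to a bounded error, and the second differences of the entropies are
    [O(n m^(-n))].  They are the coefficients of [(x - 1)^2 H(x) / x], so this
    power series converges on the disk of radius [m]; it is analytic there by the
    usual re-expansion at another centre. *)

(** * Counting expansions and sums over neighbouring frequencies *)

Definition rsum {A : Type} (g : A -> R) (l : list A) : R :=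
  fold_right Rplus 0 (map g l).

Lemma rsum_app {A : Type} (g : A -> R) (l1 l2 : list A) :
  rsum g (l1 ++ l2) = rsum g l1 + rsum g l2.
Proof.
  unfold rsum; induction l1 as [|x l1 IH]; simpl; [ring | rewrite IH; ring].
Qed.

Lemma rsum_ext_in {A : Type} (g h : A -> R) (l : list A) :
  (forall x, In x l -> g x = h x) -> rsum g l = rsum h l.
Proof. intros E; unfold rsum; rewrite (map_ext_in g h l E); reflexivity. Qed.

Lemma rsum_ext {A : Type} (g h : A -> R) (l : list A) :
  (forall x, g x = h x) -> rsum g l = rsum h l.
Proof. intros E; apply rsum_ext_in; auto. Qed.

Lemma rsum_plus {A : Type} (g h : A -> R) (l : list A) :
  rsum (fun x => g x + h x) l = rsum g l + rsum h l.
Proof.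
  unfold rsum; induction l as [|x l IH]; simpl; [ring | rewrite IH; ring].
Qed.

Lemma rsum_scal {A : Type} (c : R) (g : A -> R) (l : list A) :
  rsum (fun x => c * g x) l = c * rsum g l.
Proof.
  unfold rsum; induction l as [|x l IH]; simpl; [ring | rewrite IH; ring].
Qed.

Lemma rsum_const {A : Type} (c : R) (g : A -> R) (l : list A) :
  (forall x, In x l -> g x = c) -> rsum g l = INR (length l) * c.
Proof.
  induction l as [|x l IH]; intros Hg.
  - unfold rsum; simpl; ring.
  - change (rsum g (x :: l)) with (g x + rsum g l).
    rewrite IH by (intros y Hy; apply Hg; right; exact Hy).
    rewrite (Hg x) by (left; reflexivity).
    change (length (x :: l)) with (S (length l)); rewrite S_INR; ring.
Qed.

Lemma rsum_blocks (g : nat -> R) (d K : nat) :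
  rsum g (seq 0 (d * K)) =
  rsum (fun q => rsum (fun r => g (d * q + r)%nat) (seq 0 d)) (seq 0 K).
Proof.
  assert (shift : forall k s, rsum g (seq s k) = rsum (fun r => g (s + r)%nat) (seq 0 k)).
  { induction k as [|k IH]; intros s; [reflexivity|].
    rewrite !seq_S, !rsum_app, IH; reflexivity. }
  induction K as [|K IH].
  - rewrite Nat.mul_0_r; reflexivity.
  - replace (d * S K)%nat with (d * K + d)%nat by lia.
    rewrite seq_app, (seq_S K), !rsum_app, IH, (shift d (0 + d * K)%nat).
    f_equal; symmetry; apply Rplus_0_r.
Qed.

Definition prev (f : nat -> nat) (q : nat) : nat :=
  match q with O => O | S p => f p end.

(** The number of expansions [N = sum of s_i d^(n - i)] with digits
    [0 <= s_i < d + e], computed from the last digit: as [e < d], it is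
    [N mod d], or [N mod d + d] when [N mod d < e]. *)
Fixpoint reps (d e n : nat) (N : nat) : nat :=
  match n with
  | O => if Nat.eqb N 0 then 1 else 0
  | S n' => reps d e n' (N / d) +
            (if Nat.ltb (N mod d) e then prev (reps d e n') (N / d) else 0)
  end.

(** The range [q < 2 d^n] contains all pairs of neighbours other than [(0, 0)],
    and the children [d q + r], [r < d], of its elements are exactly the
    corresponding range at level [n + 1]. *)
Definition level_sum (d e n : nat) (psi : R -> R -> R) : R :=
  rsum (fun q => psi (INR (prev (reps d e n) q)) (INR (reps d e n q)))
       (seq 0 (2 * d ^ n)).

(** The two non-diagonal children of a pair, as in Stern's diatomic array. *)
Definition stern_op (psi : R -> R -> R) (a b : R) : R :=
  psi a (a + b) + psi (a + b) b.

Lemma level_sum_0 d e psi : level_sum d e 0 psi = psi 0 1 + psi 1 0.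
Proof. unfold level_sum, rsum; simpl; ring. Qed.

Lemma reps_child d e n q r : (r < d)%nat ->
  reps d e (S n) (d * q + r) =
  (reps d e n q + (if Nat.ltb r e then prev (reps d e n) q else 0))%nat.
Proof.
  intros Hr; simpl.
  rewrite <- (Nat.div_unique (d * q + r) d q r Hr eq_refl).
  rewrite <- (Nat.mod_unique (d * q + r) d q r Hr eq_refl).
  reflexivity.
Qed.

(** Below a pair [(a, b)], residue [0] gives the pair [(a, a + b)] because the
    residue [d - 1] to its left never has a second expansion, residues
    [1..e-1] give [(a + b, a + b)], residue [e] gives [(a + b, b)], and the
    remaining ones give [(b, b)]. *)
Lemma level_sum_S d e n psi : (1 <= e)%nat -> (e < d)%nat ->
  level_sum d e (S n) psi =
  level_sum d e n (fun a b => stern_op psi a b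
     + INR (e - 1) * psi (a + b) (a + b) + INR (d - e - 1) * psi b b).
Proof.
  intros He Hd; unfold level_sum.
  replace (2 * d ^ S n)%nat with (d * (2 * d ^ n))%nat by (simpl; lia).
  rewrite rsum_blocks; apply rsum_ext; intros q.
  replace (seq 0 d) with (seq 0 1 ++ seq 1 (e - 1) ++ seq e 1 ++ seq (S e) (d - e - 1)).
  2:{ replace d with (1 + ((e - 1) + (1 + (d - e - 1))))%nat at 2 by lia.
      rewrite !seq_app; repeat f_equal; lia. }
  set (a := prev (reps d e n) q); set (b := reps d e n q).
  assert (big : forall r, (r < d)%nat -> (e <= r)%nat -> reps d e (S n) (d * q + r) = b).
  { intros r H1 H2; rewrite reps_child by lia.
    destruct (Nat.ltb_spec r e); [lia|]; unfold b; lia. }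
  assert (small : forall r, (r < e)%nat -> reps d e (S n) (d * q + r) = (a + b)%nat).
  { intros r H1; rewrite reps_child by lia.
    destruct (Nat.ltb_spec r e); [|lia]; unfold a, b; lia. }
  assert (pS : forall r, prev (reps d e (S n)) (d * q + S r) = reps d e (S n) (d * q + r)).
  { intros r; rewrite Nat.add_succ_r; reflexivity. }
  assert (p0 : prev (reps d e (S n)) (d * q + 0) = a).
  { destruct q as [|q]; [rewrite Nat.mul_0_r; reflexivity|].
    replace (d * S q + 0)%nat with (S (d * q + (d - 1)))%nat by lia.
    change (prev (reps d e (S n)) (S (d * q + (d - 1))))
      with (reps d e (S n) (d * q + (d - 1))).
    rewrite reps_child by lia.
    destruct (Nat.ltb_spec (d - 1) e); [lia|]; unfold a; simpl prev; lia. }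
  rewrite !rsum_app.
  rewrite (rsum_const (psi (INR a) (INR a + INR b)) _ (seq 0 1)).
  2:{ intros r Hr; apply in_seq in Hr; replace r with 0%nat by lia.
      rewrite p0, small, plus_INR by lia; reflexivity. }
  rewrite (rsum_const (psi (INR a + INR b) (INR a + INR b)) _ (seq 1 (e - 1))).
  2:{ intros r Hr; apply in_seq in Hr; destruct r as [|r]; [lia|].
      rewrite pS, !small, plus_INR by lia; reflexivity. }
  rewrite (rsum_const (psi (INR a + INR b) (INR b)) _ (seq e 1)).
  2:{ intros r Hr; apply in_seq in Hr; replace r with e by lia.
      rewrite big by lia; destruct e as [|e']; [lia|].
      rewrite pS, small, plus_INR by lia; reflexivity. }
  rewrite (rsum_const (psi (INR b) (INR b)) _ (seq (S e) (d - e - 1))).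
  2:{ intros r Hr; apply in_seq in Hr; destruct r as [|r]; [lia|].
      rewrite pS, !big by lia; reflexivity. }
  rewrite !length_seq; unfold stern_op; simpl (INR 1); ring.
Qed.

Lemma level_sum_ext d e n psi psi' :
  (forall a b, 0 <= a -> 0 <= b -> psi a b = psi' a b) ->
  level_sum d e n psi = level_sum d e n psi'.
Proof. intros E; apply rsum_ext; intros q; apply E; apply pos_INR. Qed.

Lemma level_sum_plus d e n psi psi' :
  level_sum d e n (fun a b => psi a b + psi' a b) =
  level_sum d e n psi + level_sum d e n psi'.
Proof. apply rsum_plus. Qed.

Lemma level_sum_scal d e n c psi :
  level_sum d e n (fun a b => c * psi a b) = c * level_sum d e n psi.
Proof. apply (rsum_scal c). Qed.

Lemma level_sum_mass d e n : (1 <= e)%nat -> (e < d)%nat ->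
  level_sum d e n (fun a _ => a) = INR (d + e) ^ n /\
  level_sum d e n (fun _ b => b) = INR (d + e) ^ n.
Proof.
  intros He Hd; induction n as [|n [IHa IHb]].
  - rewrite !level_sum_0; simpl; lra.
  - rewrite !level_sum_S by assumption.
    rewrite (level_sum_ext _ _ _ _ (fun a b => INR (e + 1) * a + INR (d - 1) * b)).
    2:{ intros a b _ _; unfold stern_op; rewrite plus_INR, !minus_INR by lia.
        simpl (INR 1); ring. }
    rewrite (level_sum_ext _ _ _
      (fun a b => stern_op (fun _ b0 : R => b0) a b + _ + _) (fun a b => INR e * a + INR d * b)).
    2:{ intros a b _ _; unfold stern_op; rewrite !minus_INR by lia.
        simpl (INR 1); ring. }
    rewrite !level_sum_plus, !level_sum_scal, IHa, IHb; simpl pow.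
    rewrite !plus_INR, !minus_INR by lia; simpl (INR 1); split; ring.
Qed.

(** * Additivity defects of homogeneous functions *)

Definition homogeneous (G : R -> R -> R) : Prop :=
  forall c a b, 0 <= c -> 0 <= a -> 0 <= b -> G (c * a) (c * b) = c * G a b.

Lemma stern_op_homogeneous G : homogeneous G -> homogeneous (stern_op G).
Proof.
  intros HG c a b Hc Ha Hb; unfold stern_op.
  rewrite <- Rmult_plus_distr_l, !HG by lra; ring.
Qed.

Definition gap (G : R -> R -> R) (a b a' b' : R) : R :=
  G (a + a') (b + b') - G a b - G a' b'.

(** On the diagonal a homogeneous [G] is linear, and the sums of the linear
    functions are known exactly. *)
Lemma level_sum_S_homogeneous d e n G : (1 <= e)%nat -> (e < d)%nat ->
  homogeneous G ->
  level_sum d e (S n) G =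
  level_sum d e n (stern_op G) + (INR (d + e) - 3) * G 1 1 * INR (d + e) ^ n.
Proof.
  intros He Hd HG; rewrite level_sum_S by assumption.
  destruct (level_sum_mass d e n He Hd) as [Ea Eb].
  rewrite (level_sum_ext _ _ _ _
    (fun a b => stern_op G a b + G 1 1 * (INR (e - 1) * a + INR (d - 2) * b))).
  2:{ intros a b Ha Hb.
      assert (diag : forall c, 0 <= c -> G c c = c * G 1 1).
      { intros c Hc; rewrite <- HG by lra; rewrite Rmult_1_r; reflexivity. }
      rewrite (diag b), (diag (a + b)) by lra.
      rewrite !minus_INR by lia; simpl (INR 2); simpl (INR 1); ring. }
  rewrite level_sum_plus, level_sum_scal, level_sum_plus, !level_sum_scal, Ea, Eb.
  rewrite plus_INR, !minus_INR by lia; simpl (INR 2); simpl (INR 1); ring.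
Qed.

(** Applying [level_sum_S_homogeneous] to two consecutive levels, the diagonal
    terms [G 1 1 m^(n+1)] cancel, so the defect at level [n + 1] for [G] is the
    defect at level [n] for [stern_op G]; at the root, where the pairs are
    [(0, 1)] and [(1, 0)], it is the gap at the standard basis. *)
Lemma level_sum_defect d e n G : (1 <= e)%nat -> (e < d)%nat ->
  homogeneous G ->
  level_sum d e (S n) G - INR (d + e) * level_sum d e n G =
  (INR (d + e) - 1) * gap (Nat.iter n stern_op G) 1 0 0 1.
Proof.
  intros He Hd; revert G; induction n as [|n IH]; intros G HG.
  - rewrite level_sum_S_homogeneous by assumption; rewrite !level_sum_0.
    unfold gap, stern_op; simpl; rewrite !Rplus_0_r, !Rplus_0_l; ring.
  - rewrite (level_sum_S_homogeneous d e (S n) G He Hd HG),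
      (level_sum_S_homogeneous d e n G He Hd HG).
    rewrite Nat.iter_succ_r, <- IH by (apply stern_op_homogeneous; assumption).
    simpl pow; ring.
Qed.

(** A quadruple [a b a' b'] stands for the matrix with columns [(a, b)] and
    [(a', b')].  With [M0 (a, b) = (a, a + b)] and [M1 (a, b) = (a + b, b)],
    [left_op] sums over the matrices [Mi X], and [right_op] over the [X Mi]. *)
Definition left_op (K : R -> R -> R -> R -> R) (a b a' b' : R) : R :=
  K a (a + b) a' (a' + b') + K (a + b) b (a' + b') b'.

Definition right_op (K : R -> R -> R -> R -> R) (a b a' b' : R) : R :=
  K (a + a') (b + b') a' b' + K a b (a + a') (b + b').

Lemma gap_iter_stern_op n G a b a' b' :
  gap (Nat.iter n stern_op G) a b a' b' = Nat.iter n left_op (gap G) a b a' b'.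
Proof.
  revert a b a' b'; induction n as [|n IH]; intros a b a' b'; [reflexivity|].
  simpl; unfold left_op; rewrite <- !IH; unfold gap, stern_op.
  replace (a + a' + (b + b')) with (a + b + (a' + b')) by ring; ring.
Qed.

Lemma right_op_iter_left_op n K a b a' b' :
  right_op (Nat.iter n left_op K) a b a' b' =
  Nat.iter n left_op (right_op K) a b a' b'.
Proof.
  revert a b a' b'; induction n as [|n IH]; intros a b a' b'; [reflexivity|].
  simpl; unfold left_op at 3; rewrite <- !IH; unfold right_op, left_op.
  replace (a + a' + (b + b')) with (a + b + (a' + b')) by ring; ring.
Qed.

(** Reversal of words: at the identity matrix both iterates are the sum of [K]
    over all products of [n] factors [M0], [M1]. The left order comes from the
    recursion over levels, the right order is the one of the Farey tree, where
    neighbours [u], [v] are replaced by [u, u + v] and [u + v, v]. *)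
Lemma iter_left_op_eq_right_op n K :
  Nat.iter n left_op K 1 0 0 1 = Nat.iter n right_op K 1 0 0 1.
Proof.
  revert K; induction n as [|n IH]; intros K; [reflexivity|].
  rewrite (Nat.iter_succ_r n _ right_op), <- IH, <- right_op_iter_left_op; simpl.
  unfold left_op at 1, right_op; rewrite !Rplus_0_r, !Rplus_0_l; reflexivity.
Qed.

Definition farey_pair (a b a' b' : R) : Prop :=
  0 <= a /\ 0 <= b /\ 0 <= a' /\ 0 <= b' /\ 1 <= a + b /\ 1 <= a' + b' /\
  a * b' - a' * b = 1.

(** With [s = a + b] and [s' = a' + b'] this rests on
    [1 / (s (s + s')) + 1 / ((s + s') s') = 1 / (s s')]: the two halves of a
    Farey interval have the total length of the interval. *)
Lemma iter_right_op_bound n K :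
  (forall a b a' b', farey_pair a b a' b' ->
     Rabs (K a b a' b') <= / ((a + b) * (a' + b'))) ->
  forall a b a' b', farey_pair a b a' b' ->
     Rabs (Nat.iter n right_op K a b a' b') <= / ((a + b) * (a' + b')).
Proof.
  intros HK; induction n as [|n IH]; intros a b a' b' HF; [apply HK; exact HF|].
  destruct HF as (Ha & Hb & Ha' & Hb' & Hs & Hs' & Hdet).
  simpl; unfold right_op.
  eapply Rle_trans; [apply Rabs_triang|].
  eapply Rle_trans.
  { apply Rplus_le_compat; apply IH; repeat split; lra. }
  apply Req_le; field; lra.
Qed.

(** * The defect of the mediant entropy *)

Definition xlnx (x : R) : R := x * ln x.

Lemma xlnx_mul c x : 0 <= c -> 0 <= x -> xlnx (c * x) = c * xlnx x + x * xlnx c.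
Proof.
  intros Hc Hx; unfold xlnx.
  destruct (Req_dec c 0) as [->|Hc0]; [ring|].
  destruct (Req_dec x 0) as [->|Hx0]; [ring|].
  rewrite ln_mult by lra; ring.
Qed.

(** The combination for which the terms [x ln c] of [xlnx (c x)] cancel, since
    [(2a + b) + (a + 2b) = 3 (a + b)]. *)
Definition mediant_entropy (a b : R) : R :=
  xlnx (2 * a + b) + xlnx (a + 2 * b) - 3 * xlnx (a + b).

Lemma mediant_entropy_homogeneous : homogeneous mediant_entropy.
Proof.
  intros c a b Hc Ha Hb; unfold mediant_entropy.
  replace (2 * (c * a) + c * b) with (c * (2 * a + b)) by ring.
  replace (c * a + 2 * (c * b)) with (c * (a + 2 * b)) by ring.
  replace (c * a + c * b) with (c * (a + b)) by ring.
  rewrite !xlnx_mul by lra; ring.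
Qed.

(** Both bounds are [ln t <= t - 1], at [t = y / x] and at [t = x / y]. *)
Lemma relative_entropy_bounds x y : 0 < x -> 0 < y ->
  0 <= x * (ln x - ln y) - x + y <= (x - y) ^ 2 / y.
Proof.
  intros Hx Hy.
  assert (ln_le : forall t, 0 < t -> ln t <= t - 1).
  { intros t Ht; pose proof (exp_ineq1_le (ln t)) as H; rewrite exp_ln in H by exact Ht; lra. }
  assert (H1 : ln x - ln y <= x / y - 1).
  { rewrite <- ln_div by assumption; apply ln_le, Rdiv_lt_0_compat; assumption. }
  assert (H2 : ln y - ln x <= y / x - 1).
  { rewrite <- ln_div by assumption; apply ln_le, Rdiv_lt_0_compat; assumption. }
  split.
  - apply (Rmult_le_compat_l x) in H2; [|lra].
    replace (x * (y / x - 1)) with (y - x) in H2 by (field; lra); lra.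
  - apply (Rmult_le_compat_l x) in H1; [|lra].
    replace ((x - y) ^ 2 / y) with (x * (x / y - 1) - x + y) by (field; lra); lra.
Qed.

(** The log-sum inequality with a remainder. The middle term is the sum of two
    relative entropies, of [l] with respect to [rho s] and of [l'] with respect
    to [rho s'], where [rho = (l + l') / (s + s')]. As the determinant is [1] or
    [-1], both arguments differ by [1 / (s + s')] from their reference, which
    makes the remainder quadratically small. *)
Lemma log_sum_gap l l' s s' : 0 < s -> 0 < s' -> s <= l -> s' <= l' ->
  (l * s' - l' * s) ^ 2 = 1 ->
  0 <= l * (ln l - ln s) + l' * (ln l' - ln s')
       - (l + l') * (ln (l + l') - ln (s + s')) <= / (s * s' * (s + s')).
Proof.
  intros Hs Hs' Hl Hl' Hdet.
  assert (Ht : 0 < s + s') by lra.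
  assert (Hr : 1 <= (l + l') / (s + s')).
  { apply Rmult_le_reg_r with (s + s'); [lra|].
    unfold Rdiv; rewrite Rmult_assoc, Rinv_l by lra; lra. }
  set (rho := (l + l') / (s + s')) in *.
  assert (Elog : ln (l + l') - ln (s + s') = ln rho).
  { unfold rho; rewrite ln_div by lra; reflexivity. }
  destruct (relative_entropy_bounds l (rho * s)) as [L1 U1];
    [lra | apply Rmult_lt_0_compat; lra |].
  destruct (relative_entropy_bounds l' (rho * s')) as [L2 U2];
    [lra | apply Rmult_lt_0_compat; lra |].
  rewrite ln_mult in L1, U1, L2, U2 by lra.
  assert (Esum : rho * s + rho * s' = l + l') by (unfold rho; field; lra).
  assert (quad : forall x t, 0 < t -> (x - rho * t) ^ 2 = / (s + s') ^ 2 ->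
            (x - rho * t) ^ 2 / (rho * t) <= / (s + s') ^ 2 / t).
  { intros x t Htt ->; unfold Rdiv; apply Rmult_le_compat_l.
    - left; apply Rinv_0_lt_compat, pow_lt, Ht.
    - apply Rinv_le_contravar; [exact Htt|].
      rewrite <- (Rmult_1_l t) at 1; apply Rmult_le_compat_r; lra. }
  assert (Q1 := quad l s Hs).
  assert (Q2 := quad l' s' Hs').
  rewrite Elog; split; [lra|].
  replace (/ (s * s' * (s + s'))) with (/ (s + s') ^ 2 / s + / (s + s') ^ 2 / s')
    by (field; lra).
  assert (E1 : (l - rho * s) ^ 2 = / (s + s') ^ 2).
  { transitivity ((l * s' - l' * s) ^ 2 / (s + s') ^ 2);
      [unfold rho; field; lra | rewrite Hdet; field; lra]. }
  assert (E2 : (l' - rho * s') ^ 2 = / (s + s') ^ 2).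
  { transitivity ((l * s' - l' * s) ^ 2 / (s + s') ^ 2);
      [unfold rho; field; lra | rewrite Hdet; field; lra]. }
  specialize (Q1 E1); specialize (Q2 E2); lra.
Qed.

(** By the identity [(2a + b) + (a + 2b) = 3 (a + b)], the gap is minus the sum
    of two log-sum remainders, for the forms [2a + b] and [a + 2b] against
    [a + b]. *)
Lemma gap_mediant_entropy_bound a b a' b' : farey_pair a b a' b' ->
  Rabs (gap mediant_entropy a b a' b') <= / ((a + b) * (a' + b')).
Proof.
  intros (Ha & Hb & Ha' & Hb' & Hs & Hs' & Hdet).
  destruct (log_sum_gap (2 * a + b) (2 * a' + b') (a + b) (a' + b')) as [L1 U1]; try lra.
  { replace ((2 * a + b) * (a' + b') - (2 * a' + b') * (a + b))
      with (a * b' - a' * b) by ring; rewrite Hdet; ring. }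
  destruct (log_sum_gap (a + 2 * b) (a' + 2 * b') (a + b) (a' + b')) as [L2 U2]; try lra.
  { replace ((a + 2 * b) * (a' + b') - (a' + 2 * b') * (a + b))
      with (- (a * b' - a' * b)) by ring; rewrite Hdet; ring. }
  unfold gap, mediant_entropy, xlnx.
  replace (2 * (a + a') + (b + b')) with (2 * a + b + (2 * a' + b')) by ring.
  replace (a + a' + 2 * (b + b')) with (a + 2 * b + (a' + 2 * b')) by ring.
  replace (a + a' + (b + b')) with (a + b + (a' + b')) by ring.
  assert (H : 2 * / ((a + b) * (a' + b') * (a + b + (a' + b'))) <= / ((a + b) * (a' + b'))).
  { rewrite Rinv_mult.
    assert (0 < / ((a + b) * (a' + b')))
      by (apply Rinv_0_lt_compat, Rmult_lt_0_compat; lra).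
    assert (/ (a + b + (a' + b')) <= / 2) by (apply Rinv_le_contravar; lra).
    nra. }
  apply Rabs_le; lra.
Qed.

Lemma gap_iter_mediant_entropy_bound n :
  Rabs (gap (Nat.iter n stern_op mediant_entropy) 1 0 0 1) <= 1.
Proof.
  rewrite gap_iter_stern_op, iter_left_op_eq_right_op.
  replace 1 with (/ ((1 + 0) * (0 + 1))) at 3 by field.
  apply iter_right_op_bound.
  - apply gap_mediant_entropy_bound.
  - repeat split; lra.
Qed.

(** * Second differences of the entropies *)

Definition freq_entropy (d e n : nat) : R := level_sum d e n (fun _ b => xlnx b).
Definition sum_entropy (d e n : nat) : R := level_sum d e n (fun a b => xlnx (a + b)).

Lemma freq_entropy_S d e n : (1 <= e)%nat -> (e < d)%nat ->
  freq_entropy d e (S n) =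
  (INR d - INR e) * freq_entropy d e n + INR e * sum_entropy d e n.
Proof.
  intros He Hd; unfold freq_entropy, sum_entropy; rewrite level_sum_S by assumption.
  rewrite <- !level_sum_scal, <- level_sum_plus; apply level_sum_ext; intros a b _ _.
  unfold stern_op; rewrite !minus_INR by lia; simpl (INR 1); ring.
Qed.

Lemma sum_entropy_S d e n : (1 <= e)%nat -> (e < d)%nat ->
  sum_entropy d e (S n) =
  (2 * INR e + 1) * sum_entropy d e n + 2 * (INR d - INR e - 1) * freq_entropy d e n
  + level_sum d e n mediant_entropy
  + (2 * INR e + 2 * INR d - 6) * ln 2 * INR (d + e) ^ n.
Proof.
  intros He Hd; unfold freq_entropy, sum_entropy; rewrite level_sum_S by assumption.
  destruct (level_sum_mass d e n He Hd) as [Ea Eb].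
  rewrite (level_sum_ext _ _ _ _ (fun a b =>
    (2 * INR e + 1) * xlnx (a + b) + 2 * (INR d - INR e - 1) * xlnx b + mediant_entropy a b
    + (2 * (INR e - 1) * ln 2 * a + (2 * INR d - 4) * ln 2 * b))).
  - rewrite !level_sum_plus, !level_sum_scal, Ea, Eb; ring.
  - intros a b Ha Hb; unfold stern_op, mediant_entropy.
    replace (a + b + (a + b)) with (2 * (a + b)) by ring.
    replace (b + b) with (2 * b) by ring.
    rewrite !(xlnx_mul 2) by lra.
    replace (a + (a + b)) with (2 * a + b) by ring.
    replace (a + b + b) with (a + 2 * b) by ring.
    rewrite !minus_INR by lia; simpl (INR 1); unfold xlnx at 4 6; ring.
Qed.

(** The matrix of the recurrence for [(freq_entropy, sum_entropy)] has trace
    [m + 1] and determinant [m], which eliminates [sum_entropy]. A further factor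
    [E - m], with [E] the shift, kills the forcing term in [m^n] and leaves [e]
    times the defect of [mediant_entropy]. *)
Lemma freq_entropy_recurrence d e n : (1 <= e)%nat -> (e < d)%nat ->
  let m := INR (d + e) in
  Rabs (freq_entropy d e (S (S (S n))) - (2 * m + 1) * freq_entropy d e (S (S n))
    + (m ^ 2 + 2 * m) * freq_entropy d e (S n) - m ^ 2 * freq_entropy d e n) <= m ^ 2.
Proof.
  intros He Hd m.
  pose proof (level_sum_defect d e n _ He Hd mediant_entropy_homogeneous) as D.
  pose proof (gap_iter_mediant_entropy_bound n) as G.
  set (delta := gap _ _ _ _ _) in D, G.
  assert (Hm : m = INR d + INR e) by apply plus_INR.
  assert (1 <= INR e) by (apply (le_INR 1); lia).
  assert (INR e <= INR d) by (apply le_INR; lia).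
  match goal with |- Rabs ?X <= _ => replace X with (INR e * (m - 1) * delta) end.
  - rewrite Rabs_mult, (Rabs_pos_eq (INR e * (m - 1))) by (apply Rmult_le_pos; lra).
    apply Rle_trans with (INR e * (m - 1) * 1).
    + apply Rmult_le_compat_l; [apply Rmult_le_pos; lra | exact G].
    + nra.
  - fold m in D; rewrite Rmult_assoc, <- D.
    rewrite !(freq_entropy_S d e _ He Hd), !(sum_entropy_S d e _ He Hd),
      !(freq_entropy_S d e _ He Hd).
    fold m; simpl pow; rewrite Hm; ring.
Qed.

(** After division by [m^n] the characteristic roots [m], [m], [1] become [1],
    [1], [1 / m], so the second difference [y] satisfies
    [y_(n+1) = y_n / m + O(m^(-n-1))]; this resonance produces the factor
    [n + 1]. *)
Lemma freq_entropy_second_difference d e : (1 <= e)%nat -> (e < d)%nat ->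
  let m := INR (d + e) in
  let a := fun n => freq_entropy d e n / m ^ n in
  exists K, forall n, Rabs (a (S (S n)) - 2 * a (S n) + a n) <= K * (INR n + 1) / m ^ n.
Proof.
  intros He Hd m a.
  assert (Hm : 1 <= m) by (apply (le_INR 1); lia).
  set (y := fun n => a (S (S n)) - 2 * a (S n) + a n).
  assert (step : forall n, Rabs (y (S n)) <= Rabs (y n) / m + / m ^ S n).
  { intros n.
    set (rec := freq_entropy d e (S (S (S n))) - (2 * m + 1) * freq_entropy d e (S (S n))
      + (m ^ 2 + 2 * m) * freq_entropy d e (S n) - m ^ 2 * freq_entropy d e n).
    assert (Hrec : Rabs rec <= m ^ 2) by exact (freq_entropy_recurrence d e n He Hd).
    assert (Hp : 0 < m ^ n) by (apply pow_lt; lra).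
    replace (y (S n)) with (y n / m + rec / (m ^ 2 * m ^ S n))
      by (unfold y, a, rec; simpl pow; field; lra).
    eapply Rle_trans; [apply Rabs_triang|].
    unfold Rdiv; rewrite !Rabs_mult, (Rabs_pos_eq (/ m))
      by (left; apply Rinv_0_lt_compat; lra).
    apply Rplus_le_compat_l.
    assert (Hq : 0 < m ^ 2 * m ^ S n) by (apply Rmult_lt_0_compat; apply pow_lt; lra).
    rewrite (Rabs_pos_eq (/ (_ * _))) by (left; apply Rinv_0_lt_compat; exact Hq).
    apply Rle_trans with (m ^ 2 * / (m ^ 2 * m ^ S n)).
    - apply Rmult_le_compat_r; [left; apply Rinv_0_lt_compat; exact Hq | exact Hrec].
    - apply Req_le; simpl pow; field; lra. }
  exists (Rabs (y O) + 1); intros n; fold (y n).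
  assert (H : Rabs (y n) <= (Rabs (y O) + INR n) / m ^ n).
  { induction n as [|n IH].
    - simpl; apply Req_le; field.
    - eapply Rle_trans; [apply step|]; rewrite S_INR.
      assert (Hp : 0 < m ^ n) by (apply pow_lt; lra).
      replace ((Rabs (y O) + (INR n + 1)) / m ^ S n)
        with ((Rabs (y O) + INR n) / m ^ n / m + / m ^ S n) by (simpl pow; field; lra).
      apply Rplus_le_compat_r, Rmult_le_compat_r; [|exact IH].
      left; apply Rinv_0_lt_compat; lra. }
  eapply Rle_trans; [exact H|].
  apply Rmult_le_compat_r; [left; apply Rinv_0_lt_compat, pow_lt; lra|].
  pose proof (pos_INR n); pose proof (Rabs_pos (y O)); nra.
Qed.

(** * From nodes and frequencies to integer expansions *)

(** The integer behind the node of a word, read with the first letter as the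
    most significant digit. *)
Definition horner (d : nat) (sigma : list nat) : nat :=
  fold_left (fun acc i => d * acc + i)%nat sigma O.

Definition codes (m d n : nat) : list nat := map (horner d) (words m n).

Lemma horner_cons d i sigma :
  horner d (i :: sigma) = (i * d ^ length sigma + horner d sigma)%nat.
Proof.
  unfold horner; simpl; rewrite Nat.mul_0_r, Nat.add_0_l.
  assert (H : forall acc,
    fold_left (fun acc i => d * acc + i)%nat sigma acc =
    (acc * d ^ length sigma + fold_left (fun acc i => d * acc + i)%nat sigma 0)%nat).
  { induction sigma as [|j sigma IH]; intros acc; [simpl; lia|].
    simpl fold_left; rewrite (IH (d * acc + j)%nat), (IH (d * 0 + j)%nat).
    simpl; lia. }
  apply H.
Qed.

Lemma word_map_horner m d sigma : (2 <= d)%nat ->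
  word_map m d sigma 0 =
  INR (horner d sigma) * ((INR d - 1) / (INR m - 1) / INR d ^ length sigma).
Proof.
  intros Hd; assert (2 <= INR d) by (apply (le_INR 2); exact Hd).
  induction sigma as [|i sigma IH]; [simpl; unfold Rdiv; ring|].
  rewrite horner_cons; simpl word_map; unfold contraction at 1.
  change (fold_right (contraction m d) 0 sigma) with (word_map m d sigma 0).
  assert (INR d ^ length sigma <> 0) by (apply pow_nonzero; lra).
  rewrite IH, plus_INR, mult_INR, pow_INR; simpl pow.
  generalize ((INR d - 1) / (INR m - 1)); intros c; field; split; lra.
Qed.

Lemma length_words m n sigma : In sigma (words m n) -> length sigma = n.
Proof.
  revert sigma; induction n as [|n IH]; simpl; intros sigma H.
  - destruct H as [<-|[]]; reflexivity.
  - apply in_flat_map in H; destruct H as (i & _ & H).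
    apply in_map_iff in H; destruct H as (w & <- & Hw); simpl; f_equal; auto.
Qed.

Lemma endpoints_codes m d n : (2 <= d)%nat ->
  endpoints m d n =
  map (fun N => INR N * ((INR d - 1) / (INR m - 1) / INR d ^ n)) (codes m d n).
Proof.
  intros Hd; unfold endpoints, codes; rewrite map_map; apply map_ext_in.
  intros sigma H; rewrite word_map_horner, (length_words m n) by assumption; reflexivity.
Qed.

Lemma flat_map_flat_map {A B D : Type} (f : A -> list B) (g : B -> list D) l :
  flat_map g (flat_map f l) = flat_map (fun x => flat_map g (f x)) l.
Proof.
  induction l as [|x l IH]; simpl; [reflexivity | rewrite flat_map_app, IH; reflexivity].
Qed.

Lemma map_flat_map {A B D : Type} (f : A -> list B) (g : B -> D) l :
  map g (flat_map f l) = flat_map (fun x => map g (f x)) l.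
Proof.
  induction l as [|x l IH]; simpl; [reflexivity | rewrite map_app, IH; reflexivity].
Qed.

Lemma flat_map_map {A B D : Type} (f : A -> B) (g : B -> list D) l :
  flat_map g (map f l) = flat_map (fun x => g (f x)) l.
Proof. induction l as [|x l IH]; simpl; [|rewrite IH]; reflexivity. Qed.

(** The recursion for frequencies reads the last letter, while [words] adds
    letters in front; both ways list the words in lexicographic order. *)
Lemma words_snoc m n :
  words m (S n) =
  flat_map (fun w => map (fun i => w ++ i :: nil) (seq 0 m)) (words m n).
Proof.
  induction n as [|n IH].
  - simpl; rewrite app_nil_r; induction (seq 0 m); simpl; congruence.
  - transitivity (flat_map (fun i => map (cons i) (flat_map
      (fun w => map (fun j => w ++ j :: nil) (seq 0 m)) (words m n))) (seq 0 m));
      [rewrite <- IH; reflexivity|].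
    simpl words; rewrite flat_map_flat_map; apply flat_map_ext; intros i.
    rewrite map_flat_map, flat_map_map; apply flat_map_ext; intros w.
    rewrite map_map; reflexivity.
Qed.

Lemma codes_S m d n :
  codes m d (S n) =
  flat_map (fun q => map (fun i => d * q + i)%nat (seq 0 m)) (codes m d n).
Proof.
  unfold codes; rewrite words_snoc, map_flat_map, flat_map_map.
  apply flat_map_ext; intros w; rewrite map_map; apply map_ext; intros i.
  unfold horner; rewrite fold_left_app; reflexivity.
Qed.

(** The slack [2] is what makes the bound inductive:
    [d (2 d^n - 2) + (m - 1) + 2 <= 2 d^(n+1)] exactly because
    [m <= 2 d - 1]. *)
Lemma codes_bound m d n q : (1 <= d)%nat -> (m <= 2 * d - 1)%nat ->
  In q (codes m d n) -> (q + 2 <= 2 * d ^ n)%nat.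
Proof.
  intros Hd Hm; revert q; induction n as [|n IH]; intros q H.
  - destruct H as [<-|[]]; simpl; lia.
  - rewrite codes_S in H; apply in_flat_map in H; destruct H as (q' & Hq' & H).
    apply in_map_iff in H; destruct H as (i & <- & Hi); apply in_seq in Hi.
    apply IH in Hq'; simpl; nia.
Qed.

Lemma count_occ_interval a m N :
  count_occ Nat.eq_dec (map (fun i => a + i)%nat (seq 0 m)) N =
  if (Nat.leb a N && Nat.ltb N (a + m))%bool then 1%nat else 0%nat.
Proof.
  assert (E : In N (map (fun i => a + i)%nat (seq 0 m)) <-> (a <= N < a + m)%nat).
  { rewrite in_map_iff; split.
    - intros (i & <- & Hi); apply in_seq in Hi; lia.
    - intros H; exists (N - a)%nat; rewrite in_seq; lia. }
  destruct (Nat.leb_spec a N), (Nat.ltb_spec N (a + m)); simpl;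
    try (apply count_occ_not_In; rewrite E; lia).
  apply NoDup_count_occ'; [|apply E; lia].
  apply Injective_map_NoDup; [intros x y; lia | apply seq_NoDup].
Qed.

Lemma count_occ_children d e l N : (e < d)%nat ->
  count_occ Nat.eq_dec
    (flat_map (fun q => map (fun i => d * q + i)%nat (seq 0 (d + e))) l) N =
  (count_occ Nat.eq_dec l (N / d) +
   (if Nat.ltb (N mod d) e then prev (count_occ Nat.eq_dec l) (N / d) else 0))%nat.
Proof.
  intros Hd.
  assert (EN := Nat.div_mod_eq N d).
  assert (Hr := Nat.mod_upper_bound N d ltac:(lia)).
  set (Q := (N / d)%nat) in *; set (r := (N mod d)%nat) in *; clearbody Q r; subst N.
  induction l as [|q l IH].
  - simpl; destruct (Nat.ltb r e); [destruct Q|]; reflexivity.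
  - simpl flat_map; rewrite count_occ_app, IH, count_occ_interval.
    unfold prev; destruct Q as [|Q].
    + simpl count_occ; destruct (Nat.eq_dec q 0) as [->|H0].
      * destruct (Nat.leb_spec (d * 0) (d * 0 + r)), (Nat.ltb_spec (d * 0 + r) (d * 0 + (d + e)));
          simpl; lia.
      * destruct (Nat.leb_spec (d * q) (d * 0 + r)); [nia|]; simpl; lia.
    + simpl count_occ.
      destruct (Nat.eq_dec q (S Q)) as [->|H1]; [|destruct (Nat.eq_dec q Q) as [->|H2]].
      * destruct (Nat.eq_dec (S Q) Q); [lia|].
        destruct (Nat.leb_spec (d * S Q) (d * S Q + r)),
          (Nat.ltb_spec (d * S Q + r) (d * S Q + (d + e))); simpl; lia.
      * destruct (Nat.leb_spec (d * Q) (d * S Q + r)); [|nia].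
        destruct (Nat.ltb_spec (d * S Q + r) (d * Q + (d + e))), (Nat.ltb_spec r e);
          simpl; try lia; nia.
      * destruct (Nat.leb_spec (d * q) (d * S Q + r)),
          (Nat.ltb_spec (d * S Q + r) (d * q + (d + e))); simpl; try lia.
        assert (q < Q \/ q = Q \/ q = S Q \/ S Q < q)%nat as [C|[C|[C|C]]] by lia; nia.
Qed.

Lemma count_occ_codes d e n N : (e < d)%nat ->
  count_occ Nat.eq_dec (codes (d + e) d n) N = reps d e n N.
Proof.
  intros Hd; revert N; induction n as [|n IH]; intros N.
  - simpl; destruct N; reflexivity.
  - rewrite codes_S, count_occ_children by exact Hd.
    simpl; rewrite IH; destruct (N / d)%nat; simpl; [|rewrite IH]; reflexivity.
Qed.

Lemma nodup_map {A B : Type} (decA : forall x y : A, {x = y} + {x <> y})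
  (decB : forall x y : B, {x = y} + {x <> y}) (g : A -> B) (l : list A) :
  (forall x y, g x = g y -> x = y) -> nodup decB (map g l) = map g (nodup decA l).
Proof.
  intros Hg; induction l as [|x l IH]; [reflexivity|]; simpl.
  destruct (in_dec decB (g x) (map g l)) as [H|H], (in_dec decA x l) as [H'|H'];
    simpl; try rewrite IH; try reflexivity; exfalso.
  - apply in_map_iff in H; destruct H as (y & E & Hy).
    apply Hg in E; subst y; contradiction.
  - apply H, in_map, H'.
Qed.

(** Turns the sum over the distinct nodes of a level into a sum over the range
    of [level_sum]: the added integers have multiplicity [0] in [l]. *)
Lemma rsum_nodup (g : nat -> R) (l : list nat) (K : nat) :
  g O = 0 -> (forall q, In q l -> (q < K)%nat) ->
  rsum (fun q => g (count_occ Nat.eq_dec l q)) (nodup Nat.eq_dec l) =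
  rsum (fun q => g (count_occ Nat.eq_dec l q)) (seq 0 K).
Proof.
  intros Hg HK; set (w := fun q => g (count_occ Nat.eq_dec l q)).
  set (b := fun q => if in_dec Nat.eq_dec q l then true else false).
  transitivity (rsum w (filter b (seq 0 K))).
  - assert (P : Permutation (nodup Nat.eq_dec l) (filter b (seq 0 K))).
    { apply NoDup_Permutation.
      - apply NoDup_nodup.
      - apply NoDup_filter, seq_NoDup.
      - intros q; rewrite nodup_In, filter_In, in_seq; unfold b.
        destruct (in_dec Nat.eq_dec q l) as [H|H]; split; intros; try tauto.
        + split; [split; [lia | apply HK, H] | reflexivity].
        + destruct H0; discriminate. }
    unfold rsum; induction P; simpl; lra.
  - induction (seq 0 K) as [|q s IH]; [reflexivity|]; simpl filter.
    change (rsum w (q :: s)) with (w q + rsum w s); unfold b at 1.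
    destruct (in_dec Nat.eq_dec q l) as [H|H].
    + change (rsum w (q :: filter b s)) with (w q + rsum w (filter b s)); lra.
    + unfold w at 2; rewrite (proj1 (count_occ_not_In Nat.eq_dec l q) H), Hg; lra.
Qed.

(** Nodes and integers correspond through an injective scaling, and expanding
    the logarithm of [f / m^n] uses that the frequencies add up to [m^n]. *)
Lemma level_entropy_freq_entropy d e n : (2 <= d)%nat -> (1 <= e)%nat -> (e < d)%nat ->
  level_entropy (d + e) d n =
  (INR n * ln (INR (d + e)) - freq_entropy d e n / INR (d + e) ^ n) / ln 2.
Proof.
  intros H2d He Hd; set (m := (d + e)%nat).
  assert (Hm : 2 < INR m) by (apply (lt_INR 2); lia).
  assert (H2 : 2 <= INR d) by (apply (le_INR 2); lia).
  assert (Hln : 0 < ln 2) by (rewrite <- ln_1; apply ln_increasing; lra).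
  assert (Hp : 0 < INR m ^ n) by (apply pow_lt; lra).
  set (c := (INR d - 1) / (INR m - 1) / INR d ^ n).
  assert (Hc : c <> 0).
  { assert (0 < INR d ^ n) by (apply pow_lt; lra).
    unfold c; apply Rgt_not_eq; repeat apply Rdiv_lt_0_compat; lra. }
  set (g := fun N => INR N * c).
  assert (Hg : forall x y, g x = g y -> x = y).
  { intros x y E; apply INR_eq, Rmult_eq_reg_r with c; [exact E | exact Hc]. }
  assert (Eend : endpoints m d n = map g (codes m d n)) by (apply endpoints_codes, H2d).
  set (w := fun k : nat => / INR m ^ n * INR k * log2 (/ INR m ^ n * INR k)).
  assert (Elev : level_entropy m d n = - rsum (fun q => w (reps d e n q)) (seq 0 (2 * d ^ n))).
  { unfold level_entropy, level; rewrite Eend, (nodup_map Nat.eq_dec) by exact Hg.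
    rewrite map_map; f_equal.
    transitivity (rsum (fun q => w (count_occ Nat.eq_dec (codes m d n) q))
                    (nodup Nat.eq_dec (codes m d n))).
    - apply rsum_ext; intros q; unfold node_prob, freq.
      rewrite Eend, <- (count_occ_map g Nat.eq_dec) by exact Hg; reflexivity.
    - rewrite (rsum_nodup w _ (2 * d ^ n)).
      + apply rsum_ext; intros q; unfold m; rewrite count_occ_codes by exact Hd; reflexivity.
      + unfold w; simpl; ring.
      + intros q Hq; apply codes_bound in Hq; unfold m in *; lia. }
  rewrite Elev.
  assert (Emass : rsum (fun q => INR (reps d e n q)) (seq 0 (2 * d ^ n)) = INR m ^ n)
    by exact (proj2 (level_sum_mass d e n He Hd)).
  rewrite (rsum_ext _ (fun q => / INR m ^ n / ln 2 * xlnx (INR (reps d e n q))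
                         + - (INR n * ln (INR m) / INR m ^ n / ln 2) * INR (reps d e n q))).
  - rewrite rsum_plus, !rsum_scal, Emass.
    unfold freq_entropy, level_sum; field; lra.
  - intros q; unfold w, log2, xlnx.
    destruct (Nat.eq_dec (reps d e n q) 0) as [E|E].
    + rewrite E; simpl; field; lra.
    + assert (0 < INR (reps d e n q)) by (apply lt_0_INR; lia).
      rewrite ln_mult, ln_Rinv, ln_pow by (try apply Rinv_0_lt_compat; lra).
      field; lra.
Qed.

(** * Power series over the complex numbers *)

Notation is_Cseries := (is_series (K := C_AbsRing) (V := C_NormedModule)).
Notation csum a n := (sum_n (G := NormedModule.AbelianMonoid C_AbsRing C_NormedModule) a n : C).

Lemma csum_0 (a : nat -> C) : csum a 0 = a O.
Proof. apply (sum_O (G := C_NormedModule)). Qed.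

Lemma csum_S (a : nat -> C) n : csum a (S n) = (csum a n + a (S n))%C.
Proof. apply (sum_Sn (G := C_NormedModule)). Qed.

Lemma ex_series_Rmult (c : R) (a : nat -> R) :
  ex_series a -> ex_series (fun n => c * a n).
Proof. exact (ex_series_scal_l (V := R_NormedModule) c a). Qed.

Lemma filterlim_C_of_bound (s : nat -> C) (l : C) (b : nat -> R) :
  (forall n, Cmod (s n - l) <= b n) -> is_lim_seq b 0 ->
  filterlim s eventually (locally (T := C_NormedModule) l).
Proof.
  intros Hs Hb.
  apply (filterlim_locally_ball_norm (U := C_NormedModule)); intros eps.
  apply is_lim_seq_spec in Hb; destruct (Hb eps) as [N HN]; exists N; intros n Hn.
  specialize (HN n Hn); rewrite Rminus_0_r in HN.
  change (Cmod (s n - l) < eps).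
  eapply Rle_lt_trans; [apply Hs|].
  eapply Rle_lt_trans; [apply Rle_abs | exact HN].
Qed.

Lemma is_lim_seq_Cmod_minus (s : nat -> C) (l : C) :
  filterlim s eventually (locally (T := C_NormedModule) l) ->
  is_lim_seq (fun n => Cmod (s n - l)) 0.
Proof.
  intros H; apply is_lim_seq_spec; intros eps.
  assert (H' := proj1 (filterlim_locally_ball_norm (U := C_NormedModule) _ _) H eps).
  revert H'; apply filter_imp; intros n Hn.
  rewrite Rminus_0_r, Rabs_pos_eq by apply Cmod_ge_0; exact Hn.
Qed.

(** Comparison with a real series when the first terms vanish; it measures the
    truncation error of the re-expanded power series. *)
Lemma is_Cseries_tail_bound (u : nat -> C) (l : C) (b : nat -> R) (L : R) (J : nat) :
  is_Cseries u l -> is_series b L ->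
  (forall k, (k <= J)%nat -> u k = 0) -> (forall k, Cmod (u k) <= b k) ->
  Cmod l <= L - sum_n b J.
Proof.
  intros Hu Hb H0 Hle.
  assert (Hz : forall n, (n <= J)%nat -> csum u n = RtoC 0).
  { induction n as [|n IH]; intros Hn; [rewrite csum_0; apply H0, Hn|].
    rewrite csum_S, IH, H0 by lia; ring. }
  assert (Hn : forall n, Cmod (csum u (J + n)) <= sum_n b (J + n) - sum_n b J).
  { induction n as [|n IH].
    - rewrite Nat.add_0_r, Hz, Cmod_0 by lia; lra.
    - rewrite Nat.add_succ_r, csum_S, sum_Sn.
      eapply Rle_trans; [apply Cmod_triangle|].
      specialize (Hle (S (J + n))); unfold plus; simpl; lra. }
  assert (L1 : is_lim_seq (fun n => Cmod (csum u n)) (Cmod l)).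
  { apply (filterlim_comp _ _ _ _ _ _ _ _ Hu).
    apply (filterlim_norm (V := C_NormedModule)). }
  assert (L2 : is_lim_seq (fun n => sum_n b n - sum_n b J) (L - sum_n b J)).
  { apply is_lim_seq_minus'; [exact Hb | apply is_lim_seq_const]. }
  assert (E : eventually (fun n => Cmod (csum u n) <= sum_n b n - sum_n b J)).
  { exists J; intros n HJ; replace n with (J + (n - J))%nat by lia; apply Hn. }
  exact (filterlim_le _ _ _ _ E L1 L2).
Qed.

(** The coefficient of [w^j] in [(z + w)^k]. *)
Fixpoint binom_coef (z : C) (k j : nat) : C :=
  match k, j with
  | O, O => 1
  | O, S _ => 0
  | S k', O => (z * binom_coef z k' O)%C
  | S k', S j' => (z * binom_coef z k' (S j') + binom_coef z k' j')%C
  end.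

Definition binom_partial (z w : C) (k J : nat) : C :=
  csum (fun j => binom_coef z k j * w ^ j)%C J.

Lemma binom_partial_0 z w k : binom_partial z w k 0 = (z ^ k)%C.
Proof.
  unfold binom_partial; rewrite csum_0; simpl.
  induction k as [|k IH]; simpl; [ring|].
  rewrite <- IH; ring.
Qed.

Lemma binom_partial_S z w k J :
  binom_partial z w (S k) (S J) =
  (z * binom_partial z w k (S J) + w * binom_partial z w k J)%C.
Proof.
  unfold binom_partial; induction J as [|J IH].
  - rewrite !csum_S, !csum_0; simpl; ring.
  - rewrite csum_S, IH, (csum_S _ (S J)), (csum_S _ J); simpl; ring.
Qed.

Lemma binom_partial_O z w J : binom_partial z w 0 J = 1.
Proof.
  unfold binom_partial; induction J as [|J IH].
  - rewrite csum_0; simpl; ring.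
  - rewrite csum_S, IH; simpl; ring.
Qed.

Lemma binom_partial_full z w k J : (k <= J)%nat -> binom_partial z w k J = ((z + w) ^ k)%C.
Proof.
  revert J; induction k as [|k IH]; intros J HJ; [apply binom_partial_O|].
  destruct J as [|J]; [lia|].
  rewrite binom_partial_S, !IH by lia; simpl; ring.
Qed.

Lemma binom_partial_bound z w k J :
  Cmod (binom_partial z w k J) <= (Cmod z + Cmod w) ^ k.
Proof.
  assert (Hz := Cmod_ge_0 z); assert (Hw := Cmod_ge_0 w).
  revert J; induction k as [|k IH]; intros J.
  - rewrite binom_partial_O, Cmod_1; simpl; lra.
  - destruct J as [|J].
    + rewrite binom_partial_0, Cmod_pow; apply pow_incr; lra.
    + rewrite binom_partial_S; eapply Rle_trans; [apply Cmod_triangle|].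
      rewrite !Cmod_mult, <- tech_pow_Rmult, Rmult_plus_distr_r.
      apply Rplus_le_compat; apply Rmult_le_compat_l; auto.
Qed.

Lemma binom_coef_bound z eta k j : 0 <= eta ->
  Cmod (binom_coef z k j) * eta ^ j <= (Cmod z + eta) ^ k.
Proof.
  intros He; assert (Hz := Cmod_ge_0 z).
  revert j; induction k as [|k IH]; intros [|j]; simpl.
  - rewrite Cmod_1; lra.
  - rewrite Cmod_0; lra.
  - rewrite Cmod_mult; specialize (IH O); simpl in IH.
    assert (0 <= (Cmod z + eta) ^ k) by (apply pow_le; lra).
    rewrite Rmult_assoc, Rmult_plus_distr_r.
    assert (Cmod z * (Cmod (binom_coef z k 0) * 1) <= Cmod z * (Cmod z + eta) ^ k)
      by (apply Rmult_le_compat_l; assumption).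
    nra.
  - assert (I1 := IH (S j)); assert (I2 := IH j); simpl in I1.
    assert (Hp : 0 <= eta * eta ^ j) by (apply (pow_le eta (S j)); exact He).
    apply Rle_trans with
      (Cmod z * (Cmod (binom_coef z k (S j)) * (eta * eta ^ j))
       + eta * (Cmod (binom_coef z k j) * eta ^ j)).
    + replace (Cmod z * (Cmod (binom_coef z k (S j)) * (eta * eta ^ j))
        + eta * (Cmod (binom_coef z k j) * eta ^ j))
        with ((Cmod z * Cmod (binom_coef z k (S j)) + Cmod (binom_coef z k j))
              * (eta * eta ^ j)) by ring.
      apply Rmult_le_compat_r; [exact Hp|].
      rewrite <- Cmod_mult; apply Cmod_triangle.
    + rewrite Rmult_plus_distr_r.
      apply Rplus_le_compat; apply Rmult_le_compat_l; assumption.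
Qed.

(** The re-expansion at [z0] has the coefficients
    [a_j = sum over k of c_k binom_coef z0 k j]. Its partial sum up to [J] is a
    single series in [k], with the truncated binomial expansions of
    [(z0 + w)^k] in place of the powers; it agrees with the series of [T] for
    [k <= J], so their distance is a tail of [2 |c_k| (|z0| + |w|)^k]. No
    interchange of two infinite sums is involved. *)
Lemma analytic_on_of_power_series (c : nat -> C) (rho : R) (T : C -> C) :
  (forall r, 0 <= r < rho -> ex_series (fun k => Cmod (c k) * r ^ k)) ->
  (forall z, Cmod z < rho -> is_Cseries (fun k => c k * z ^ k)%C (T z)) ->
  analytic_on (fun z => Cmod z < rho) T.
Proof.
  intros Hc HT z0 Hz0.
  assert (Hz0' := Cmod_ge_0 z0).
  (* With half the distance to the boundary, [|z0| + eta] is below [rho]. *)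
  set (eta := (rho - Cmod z0) / 2); assert (Heta : 0 < eta) by (unfold eta; lra).
  assert (Hex : forall j, exists l, is_Cseries (fun k => c k * binom_coef z0 k j)%C l).
  { intros j.
    apply (ex_series_le (V := C_CompleteNormedModule)
             _ (fun k => / eta ^ j * (Cmod (c k) * (Cmod z0 + eta) ^ k))).
    - intros k; change (Cmod (c k * binom_coef z0 k j) <=
        / eta ^ j * (Cmod (c k) * (Cmod z0 + eta) ^ k)).
      assert (Hp : 0 < eta ^ j) by (apply pow_lt; exact Heta).
      rewrite Cmod_mult.
      apply Rmult_le_reg_r with (eta ^ j); [exact Hp|].
      replace (/ eta ^ j * (Cmod (c k) * (Cmod z0 + eta) ^ k) * eta ^ j)
        with (Cmod (c k) * (Cmod z0 + eta) ^ k) by (field; lra).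
      rewrite Rmult_assoc; apply Rmult_le_compat_l; [apply Cmod_ge_0|].
      apply binom_coef_bound; lra.
    - apply (ex_series_Rmult (/ eta ^ j)), Hc; unfold eta; lra. }
  set (a := fun j => epsilon (inhabits (RtoC 0))
              (fun l => is_Cseries (fun k => c k * binom_coef z0 k j)%C l)).
  assert (Ha : forall j, is_Cseries (fun k => c k * binom_coef z0 k j)%C (a j))
    by (intros j; apply epsilon_spec, Hex).
  exists a, eta; split; [exact Heta|]; intros z Hz.
  set (w := (z - z0)%C) in *.
  set (r := Cmod z0 + Cmod w).
  assert (Hw := Cmod_ge_0 w).
  assert (Hr : 0 <= r < rho) by (unfold r, eta in *; lra).
  assert (Ez : (z0 + w)%C = z) by (unfold w; ring).
  assert (Hzr : Cmod z <= r) by (rewrite <- Ez; apply Cmod_triangle).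
  set (b := fun k => 2 * (Cmod (c k) * r ^ k)).
  assert (Hb : ex_series b) by (apply (ex_series_Rmult 2), Hc, Hr).
  destruct Hb as [L HL].
  assert (HA : forall J, is_Cseries (fun k => c k * binom_partial z0 w k J)%C
                 (csum (fun j => scal (pow_n (K := C_AbsRing) w j) (a j)) J)).
  { assert (Hone : forall j, is_Cseries (fun k => c k * (binom_coef z0 k j * w ^ j))%C
                     (pow_n (K := C_AbsRing) w j * a j)%C).
    { intros j; assert (Ep : pow_n (K := C_AbsRing) w j = (w ^ j)%C).
      { induction j as [|j IH]; [reflexivity|]; simpl; rewrite IH; reflexivity. }
      rewrite Ep.
      eapply is_series_ext;
        [|exact (is_series_scal_l (V := C_NormedModule) (w ^ j)%C _ _ (Ha j))].
      intros k; unfold scal; simpl; unfold mult; simpl; ring. }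
    unfold binom_partial; induction J as [|J IH].
    - rewrite csum_0.
      eapply is_series_ext; [|exact (Hone O)].
      intros k; rewrite csum_0; reflexivity.
    - rewrite csum_S.
      eapply is_series_ext;
        [|exact (is_series_plus (V := C_NormedModule) _ _ _ _ IH (Hone (S J)))].
      intros k; rewrite csum_S; unfold plus; simpl; ring. }
  apply (filterlim_C_of_bound _ _ (fun J => L - sum_n b J)).
  - intros J.
    apply (is_Cseries_tail_bound
      (fun k => c k * binom_partial z0 w k J - c k * z ^ k)%C _ b).
    + exact (is_series_minus (V := C_NormedModule) _ _ _ _ (HA J)
               (HT z (Rle_lt_trans _ _ _ Hzr (proj2 Hr)))).
    + exact HL.
    + intros k Hk; rewrite binom_partial_full, Ez by exact Hk; ring.
    + intros k; unfold b.
      replace (c k * binom_partial z0 w k J - c k * z ^ k)%C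
        with (c k * (binom_partial z0 w k J + - z ^ k))%C by ring.
      rewrite Cmod_mult.
      assert (Cmod (binom_partial z0 w k J + - z ^ k) <= 2 * r ^ k).
      { eapply Rle_trans; [apply Cmod_triangle|]; rewrite Cmod_opp, Cmod_pow.
        assert (Cmod z ^ k <= r ^ k) by (apply pow_incr; split; [apply Cmod_ge_0 | exact Hzr]).
        pose proof (binom_partial_bound z0 w k J) as B; fold r in B; lra. }
      pose proof (Cmod_ge_0 (c k)); nra.
  - replace (Finite 0) with (Finite (L - L)) by (f_equal; ring).
    apply is_lim_seq_minus'; [apply is_lim_seq_const | exact HL].
Qed.

(** By Bernoulli's inequality [(1 + x)^n] dominates [n + 1] up to a constant for
    every [x > 0]; the choice [x = (1 - q) / 2] keeps [(1 + x) q < 1]. *)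
Lemma linear_geom_bound (q : R) : 0 <= q < 1 ->
  exists M p, 0 <= M /\ 0 <= p < 1 /\ forall n, (INR n + 1) * q ^ n <= M * p ^ n.
Proof.
  intros Hq; set (x := (1 - q) / 2); assert (Hx : 0 < x) by (unfold x; lra).
  exists (/ x + 1), ((1 + x) * q).
  assert (Hix : 0 < / x) by (apply Rinv_0_lt_compat, Hx).
  split; [lra|]; split; [unfold x; nra|].
  intros n; rewrite Rpow_mult_distr, <- Rmult_assoc.
  apply Rmult_le_compat_r; [apply pow_le; lra|].
  pose proof (poly n x Hx) as B; pose proof (pos_INR n).
  apply Rle_trans with ((/ x + 1) * (1 + INR n * x)).
  - replace ((/ x + 1) * (1 + INR n * x)) with (/ x + 1 + INR n + INR n * x) by (field; lra).
    nra.
  - apply Rmult_le_compat_l; lra.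
Qed.

(** The coefficient of [x^k] in [(1 - x)^2] times the sum of the
    [h (k + 1) x^k], when [h 0 = 0]; hence the shift of index. *)
Definition second_difference (h : nat -> R) (k : nat) : R :=
  match k with
  | O => h 1%nat - 2 * h O
  | S p => h (S (S p)) - 2 * h (S p) + h p
  end.

Lemma second_difference_summable (h : nat -> R) (K rho : R) : 0 < rho ->
  (forall n, Rabs (h (S (S n)) - 2 * h (S n) + h n) <= K * (INR n + 1) / rho ^ n) ->
  forall r, 0 <= r < rho ->
    ex_series (fun k => Cmod (RtoC (second_difference h k)) * r ^ k).
Proof.
  intros Hrho Hh r Hr.
  assert (HK : 0 <= K).
  { specialize (Hh O); simpl in Hh; pose proof (Rabs_pos (h 2%nat - 2 * h 1%nat + h O)); lra. }
  destruct (linear_geom_bound (r / rho)) as (M & p & HM & Hp & HMp).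
  { split; [apply Rdiv_le_0_compat; lra|].
    apply Rmult_lt_reg_r with rho; [exact Hrho|].
    unfold Rdiv; rewrite Rmult_assoc, Rinv_l; lra. }
  apply ex_series_incr_1.
  apply (ex_series_le (V := R_CompleteNormedModule) _ (fun k => K * r * M * p ^ k)).
  - intros k; change (Rabs (Cmod (RtoC (second_difference h (S k))) * r ^ S k)
                        <= K * r * M * p ^ k).
    rewrite Cmod_R, Rabs_mult, Rabs_Rabsolu, (Rabs_pos_eq (r ^ S k))
      by (apply pow_le; lra); simpl second_difference.
    assert (Hpk : 0 < rho ^ k) by (apply pow_lt, Hrho).
    apply Rle_trans with (K * (INR k + 1) / rho ^ k * r ^ S k).
    + apply Rmult_le_compat_r; [apply pow_le; lra | apply Hh].
    + replace (K * (INR k + 1) / rho ^ k * r ^ S k)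
        with (K * r * ((INR k + 1) * (r / rho) ^ k))
        by (unfold Rdiv; rewrite Rpow_mult_distr, pow_inv; simpl; field; lra).
      rewrite (Rmult_assoc (K * r)); apply Rmult_le_compat_l; [nra | apply HMp].
  - apply (ex_series_Rmult (K * r * M)), ex_series_geom.
    rewrite Rabs_pos_eq; lra.
Qed.

Lemma linear_growth (h : nat -> R) : h O = 0 ->
  ex_series (fun k => Cmod (RtoC (second_difference h k))) ->
  exists K, forall n, Rabs (h n) <= K * INR n.
Proof.
  intros H0 [K HK]; exists K.
  assert (Hpart : forall n, sum_n (fun k => Cmod (RtoC (second_difference h k))) n <= K).
  { intros n; apply (is_lim_seq_incr_compare _ _ HK).
    intros k; rewrite sum_Sn; unfold plus; simpl.
    pose proof (Cmod_ge_0 (RtoC (second_difference h (S k)))); simpl in *; lra. }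
  assert (Hdiff : forall n, Rabs (h (S n) - h n) <= K).
  { intros n; eapply Rle_trans; [|apply (Hpart n)].
    induction n as [|n IH].
    - rewrite sum_O, Cmod_R; simpl second_difference; rewrite H0.
      apply Req_le; f_equal; ring.
    - rewrite sum_Sn, Cmod_R; unfold plus; simpl.
      replace (h (S (S n)) - h (S n))
        with ((h (S n) - h n) + (h (S (S n)) - 2 * h (S n) + h n)) by ring.
      eapply Rle_trans; [apply Rabs_triang|]; simpl in IH; lra. }
  induction n as [|n IH].
  - rewrite H0, Rabs_R0; simpl; lra.
  - rewrite S_INR; replace (h (S n)) with (h n + (h (S n) - h n)) by ring.
    eapply Rle_trans; [apply Rabs_triang|]; specialize (Hdiff n); lra.
Qed.

(** [T] is the power series of the second differences. Multiplication of a
    partial sum of the [h (k + 1) x^k] by [(x - 1)^2] telescopes to a partial sum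
    of [T x] up to two boundary terms, and these vanish in the limit because [h]
    grows at most linearly. *)
Lemma generating_function_factor (h : nat -> R) (K rho : R) : 1 < rho -> h O = 0 ->
  (forall n, Rabs (h (S (S n)) - 2 * h (S n) + h n) <= K * (INR n + 1) / rho ^ n) ->
  exists T : C -> C,
    analytic_on (fun z => Cmod z < rho) T /\
    forall x, Cmod x < 1 ->
      is_Cseries (fun k => RtoC (h (S k)) * x ^ S k)%C (x / (x - 1) ^ 2 * T x)%C.
Proof.
  intros Hrho H0 Hh.
  set (c := fun k => RtoC (second_difference h k)).
  assert (Hsum := second_difference_summable h K rho ltac:(lra) Hh).
  assert (Hex : forall z, Cmod z < rho -> exists l, is_Cseries (fun k => c k * z ^ k)%C l).
  { intros z Hz.
    apply (ex_series_le (V := C_CompleteNormedModule)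
             _ (fun k => Cmod (c k) * Cmod z ^ k)).
    - intros k; change (Cmod (c k * z ^ k) <= Cmod (c k) * Cmod z ^ k).
      rewrite Cmod_mult, Cmod_pow; apply Rle_refl.
    - apply Hsum; split; [apply Cmod_ge_0 | exact Hz]. }
  set (T := fun z => epsilon (inhabits (RtoC 0)) (fun l => is_Cseries (fun k => c k * z ^ k)%C l)).
  assert (HT : forall z, Cmod z < rho -> is_Cseries (fun k => c k * z ^ k)%C (T z))
    by (intros z Hz; apply epsilon_spec, Hex, Hz).
  exists T; split; [exact (analytic_on_of_power_series c rho T Hsum HT)|].
  intros x Hx.
  destruct (linear_growth h H0) as [G HG].
  { eapply ex_series_ext; [|apply (Hsum 1); lra].
    intros k; simpl; rewrite pow1; apply Rmult_1_r. }
  assert (HG0 : 0 <= G).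
  { specialize (HG 1%nat); simpl in HG; pose proof (Rabs_pos (h 1%nat)); lra. }
  destruct (linear_geom_bound (Cmod x)) as (M & p & HM & Hp & HMp);
    [split; [apply Cmod_ge_0 | exact Hx]|].
  assert (Hx1 : (x - 1)%C <> 0).
  { intros E; assert (x = 1) by (rewrite <- (Cplus_0_r 1), <- E; ring).
    subst x; rewrite Cmod_1 in Hx; lra. }
  (* The boundary terms of the two summations by parts. *)
  set (E := fun n => (x ^ S n * (RtoC (h n) - 2 * RtoC (h (S n)))
                      + x ^ S (S n) * RtoC (h (S n)))%C).
  assert (Hpart : forall n, csum (fun k => RtoC (h (S k)) * x ^ S k)%C n =
            (x / (x - 1) ^ 2 * (csum (fun k => c k * x ^ k) n + E n))%C).
  { induction n as [|n IH].
    - rewrite !csum_0; unfold E, c, second_difference; rewrite H0.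
      rewrite !RtoC_minus, !RtoC_mult; simpl; field; exact Hx1.
    - rewrite !csum_S, IH; unfold E, c, second_difference.
      rewrite !RtoC_plus, !RtoC_minus, !RtoC_mult; simpl; field; exact Hx1. }
  set (q := (x / (x - 1) ^ 2)%C) in *.
  apply (filterlim_C_of_bound _ _ (fun n =>
    Cmod q * (Cmod (csum (fun k => c k * x ^ k)%C n - T x) + 4 * G * M * p ^ n))).
  - intros n.
    change (Cmod (csum (fun k => RtoC (h (S k)) * x ^ S k)%C n - q * T x) <=
      Cmod q * (Cmod (csum (fun k => c k * x ^ k)%C n - T x) + 4 * G * M * p ^ n)).
    rewrite Hpart.
    replace (q * (csum (fun k => c k * x ^ k)%C n + E n) - q * T x)%C
      with (q * ((csum (fun k => c k * x ^ k)%C n - T x) + E n))%C by ring.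
    rewrite Cmod_mult; apply Rmult_le_compat_l; [apply Cmod_ge_0|].
    eapply Rle_trans; [apply Cmod_triangle|]; apply Rplus_le_compat_l.
    assert (HE : Cmod (E n) <= 4 * G * ((INR n + 1) * Cmod x ^ n)).
    { replace (E n) with (x ^ n * (x * (RtoC (h n) + (- 2 + x) * RtoC (h (S n)))))%C
        by (unfold E; simpl; ring).
      rewrite !Cmod_mult, Cmod_pow.
      assert (B : Cmod (RtoC (h n) + (- 2 + x) * RtoC (h (S n))) <= 4 * G * (INR n + 1)).
      { eapply Rle_trans; [apply Cmod_triangle|]; rewrite Cmod_mult, !Cmod_R.
        assert (B1 := HG n); assert (B2 := HG (S n)); rewrite S_INR in B2.
        assert (B3 : Cmod (- 2 + x) <= 3).
        { eapply Rle_trans; [apply Cmod_triangle|].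
          rewrite Cmod_R, Rabs_left; lra. }
        assert (B4 : Cmod (- 2 + x) * Rabs (h (S n)) <= 3 * (G * (INR n + 1))).
        { apply Rmult_le_compat; auto using Cmod_ge_0, Rabs_pos. }
        nra. }
      assert (P : 0 <= Cmod x ^ n) by (apply pow_le, Cmod_ge_0).
      pose proof (Cmod_ge_0 (RtoC (h n) + (- 2 + x) * RtoC (h (S n)))).
      pose proof (Cmod_ge_0 x).
      apply Rle_trans with (Cmod x ^ n * (1 * (4 * G * (INR n + 1)))); [|nra].
      apply Rmult_le_compat_l; [exact P|].
      apply Rmult_le_compat; lra. }
    eapply Rle_trans; [exact HE|].
    rewrite !Rmult_assoc; do 2 (apply Rmult_le_compat_l; [lra|]); apply HMp.
  - replace (Finite 0) with (Finite (Cmod q * (0 + 4 * G * M * 0))) by (f_equal; ring).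
    apply (is_lim_seq_scal_l _ (Cmod q) (Finite _)), is_lim_seq_plus'.
    + apply is_lim_seq_Cmod_minus, HT; lra.
    + apply (is_lim_seq_scal_l _ (4 * G * M) (Finite 0)), is_lim_seq_geom.
      rewrite Rabs_pos_eq; lra.
Qed.

(** * The generating function of the entropies *)

Theorem theorem3p4 : forall (m d : nat),
  (2 <= d)%nat -> (d < m)%nat -> (m <= 2 * d - 1)%nat ->
  exists T : C -> C,
    analytic_on (fun z : C => Cmod z < INR m) T /\
    forall x : C, Cmod x < 1 ->
      is_series (K := C_AbsRing) (V := C_NormedModule)
        (fun k : nat => (RtoC (level_entropy m d (S k)) * x ^ (S k))%C)
        (x / (x - 1) ^ 2 * T x)%C.
Proof.
  intros m d H2d Hdm Hm.
  assert (Em : m = (d + (m - d))%nat) by lia.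
  set (e := (m - d)%nat) in Em.
  assert (He : (1 <= e)%nat) by lia.
  assert (Hd : (e < d)%nat) by lia.
  clearbody e; subst m.
  assert (Hln : 0 < ln 2) by (rewrite <- ln_1; apply ln_increasing; lra).
  destruct (freq_entropy_second_difference d e He Hd) as [K HK].
  apply (generating_function_factor _ (K / ln 2)).
  - apply (lt_INR 1); lia.
  - rewrite level_entropy_freq_entropy by assumption.
    unfold freq_entropy; rewrite level_sum_0; unfold xlnx; simpl; rewrite ln_1.
    field; lra.
  - intros n; rewrite !level_entropy_freq_entropy, !S_INR by assumption.
    specialize (HK n).
    match goal with |- Rabs ?X <= _ =>
      replace X with (- (freq_entropy d e (S (S n)) / INR (d + e) ^ S (S n)
        - 2 * (freq_entropy d e (S n) / INR (d + e) ^ S n)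
        + freq_entropy d e n / INR (d + e) ^ n) * / ln 2) end.
    + rewrite Rabs_mult, Rabs_Ropp, (Rabs_pos_eq (/ ln 2))
        by (left; apply Rinv_0_lt_compat; exact Hln).
      replace (K / ln 2 * (INR n + 1) / INR (d + e) ^ n)
        with (K * (INR n + 1) / INR (d + e) ^ n * / ln 2) by (unfold Rdiv; ring).
      apply Rmult_le_compat_r; [left; apply Rinv_0_lt_compat; exact Hln | exact HK].
    + unfold Rdiv; ring.
Qed.
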